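(* An entailment relation $\models^\mathcal{D}_{\mathsf{G}^2_{(\rightarrow,-\!<)}}$ is validity-stable iff there is a point-generated filter $\mathcal{D}'$ s.t.\ $\mathcal{D}\subseteq\mathcal{D}'$.
   Context: $\mathsf{G}^2_{(\rightarrow,-\!<)}$: formulas built from variables with $\neg$ (strong negation), ${\sim},\triangle,\wedge,\vee,\rightarrow$ and co-implication $-\!<$. Write $a\rightarrow_{\mathsf{G}} b=1$ if $a\leq b$ else $b$, and $a-\!<_{\mathsf{G}} b=0$ if $a\leq b$ else $a$. A valuation is a pair $v=\langle v_1,v_2\rangle$ of maps from variables to $[0,1]$ extended by: $v_1(\neg\phi)=v_2(\phi)$, $v_2(\neg\phi)=v_1(\phi)$; $v_1(\triangle\phi)=1$ iff $v_1(\phi)=1$ (else $0$), $v_2(\triangle\phi)=1$ iff $v_2(\phi)>0$ (else $0$); $v_1({\sim}\phi)=1$ iff $v_1(\phi)=0$ (else $0$), $v_2({\sim}\phi)=1-\!<_{\mathsf{G}}v_2(\phi)$; $v_1(\phi\wedge\chi)=\min$, $v_2(\phi\wedge\chi)=\max$; $v_1(\phi\vee\chi)=\max$, $v_2(\phi\vee\chi)=\min$; $v_1(\phi\rightarrow\chi)=v_1(\phi)\rightarrow_{\mathsf{G}}v_1(\chi)$, $v_2(\phi\rightarrow\chi)=v_2(\chi)-\!<_{\mathsf{G}}v_2(\phi)$; $v_1(\phi-\!<\chi)=v_1(\phi)-\!<_{\mathsf{G}}v_1(\chi)$, $v_2(\phi-\!<\chi)=v_2(\chi)\rightarrow_{\mathsf{G}}v_2(\phi)$.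 $\phi$ is valid iff $v(\phi)=\langle1,0\rangle$ for all $v$. $[0,1]^{\Join}=[0,1]^2$ with the truth order $\langle x,y\rangle\leq\langle x',y'\rangle$ iff $x\leq x'$ and $y\geq y'$; a filter is a non-empty proper subset closed under meets and upward closed in this order. For $\langle x,y\rangle\neq\langle0,1\rangle$, the point-generated filter is $\langle x,y\rangle^\uparrow=\{\langle x',y'\rangle\mid x'\geq x,\,y'\leq y\}$. With $v[\Gamma]=\langle\inf_{\phi\in\Gamma}v_1(\phi),\sup_{\phi\in\Gamma}v_2(\phi)\rangle$, $\Gamma\models^\mathcal{D}_{\mathsf{G}^2_{(\rightarrow,-\!<)}}\chi$ iff for every $v$, $v[\Gamma]\in\mathcal{D}$ implies $v(\chi)\in\mathcal{D}$. It is validity-stable iff: $v(\phi)\in\mathcal{D}$ for every $v$ iff $\phi$ is valid. *)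

(* Defs.v *)
From HB Require Import structures.
From mathcomp Require Import all_boot all_order all_algebra.
From mathcomp Require Import boolp classical_sets reals.

Set Implicit Arguments.
Unset Strict Implicit.
Unset Printing Implicit Defensive.

Import Order.TTheory GRing.Theory Num.Theory.
Local Open Scope classical_set_scope.
Local Open Scope ring_scope.

Inductive formula : Type :=
| Var of nat
| SNeg of formula                (* strong negation *)
| Sim of formula                 (* Goedel negation [~] *)
| Tri of formula                 (* Baaz' Delta *)
| And of formula & formula
| Or of formula & formula
| Imp of formula & formula
| Coimp of formula & formula.

Section Semantics.
Context {R : realType}.

Definition gimp (a b : R) : R := if a <= b then 1 else b.
Definition gcoimp (a b : R) : R := if a <= b then 0 else a.

Definition in01 (x : R) : Prop := 0 <= x <= 1.

Record valuation := Valuation {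
  val1 : nat -> R;
  val2 : nat -> R;
  val1P : forall p, in01 (val1 p);
  val2P : forall p, in01 (val2 p) }.

(* The first component is support of truth v_1, the second support of falsity v_2. *)
Fixpoint eval (v : valuation) (phi : formula) : R * R :=
  match phi with
  | Var p => (val1 v p, val2 v p)
  | SNeg f => let a := eval v f in (a.2, a.1)
  | Sim f => let a := eval v f in
      (if a.1 == 0 then 1 else 0, gcoimp 1 a.2)
  | Tri f => let a := eval v f in
      (if a.1 == 1 then 1 else 0, if 0 < a.2 then 1 else 0)
  | And f g => let a := eval v f in let b := eval v g in
      (Num.min a.1 b.1, Num.max a.2 b.2)
  | Or f g => let a := eval v f in let b := eval v g in
      (Num.max a.1 b.1, Num.min a.2 b.2)
  | Imp f g => let a := eval v f in let b := eval v g in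
      (gimp a.1 b.1, gcoimp b.2 a.2)
  | Coimp f g => let a := eval v f in let b := eval v g in
      (gcoimp a.1 b.1, gimp b.2 a.2)
  end.

Definition valid (phi : formula) : Prop :=
  forall v : valuation, eval v phi = (1, 0).

Definition square : set (R * R) := [set a | in01 a.1 /\ in01 a.2].

Definition truth_le (a b : R * R) : Prop := a.1 <= b.1 /\ b.2 <= a.2.

Definition truth_meet (a b : R * R) : R * R :=
  (Num.min a.1 b.1, Num.max a.2 b.2).

Record is_filter (D : set (R * R)) : Prop := IsFilter {
  filter_sub : D `<=` square;
  filter_nonempty : D !=set0;
  filter_proper : D <> square;
  filter_meet : forall a b, D a -> D b -> D (truth_meet a b);
  filter_up : forall a b, D a -> square b -> truth_le a b -> D b }.

Definition upset (a : R * R) : set (R * R) :=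
  [set b | square b /\ truth_le a b].

Definition point_generated (D : set (R * R)) : Prop :=
  exists a : R * R, [/\ square a, a <> (0, 1) & D = upset a].

(* The infimum and supremum are those of [0, 1]: adjoining 1 (resp. 0) changes
   nothing for nonempty G and gives (1, 0) for empty G, whereas [inf set0] in R
   is the default value 0. *)
Definition eval_set (v : valuation) (G : set formula) : R * R :=
  (inf (1 |` [set (eval v phi).1 | phi in G]),
   sup (0 |` [set (eval v phi).2 | phi in G])).

Definition entails (D : set (R * R)) (G : set formula) (chi : formula) : Prop :=
  forall v : valuation, D (eval_set v G) -> D (eval v chi).

(* Stability of [entails D]; [entails_set0P] expresses it by the relation. *)
Definition validity_stable (D : set (R * R)) : Prop :=
  forall phi : formula, (forall v : valuation, D (eval v phi)) <-> valid phi.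

Lemma entails_set0P (D : set (R * R)) (phi : formula) : is_filter D ->
  entails D set0 phi <-> forall v : valuation, D (eval v phi).
Proof.
move=> FD.
have D10 : D (1, 0).
  have [a Da] := filter_nonempty FD.
  have [/andP[_ a1] /andP[a2 _]] := filter_sub FD Da.
  apply: (filter_up FD Da); last by split.
  by split; rewrite /in01 /= ?lexx ?ler01.
by split=> [h v|h v _ //]; apply: h; rewrite /eval_set !image_set0 !setU0 inf1 sup1.
Qed.

Lemma eval_square (v : valuation) (phi : formula) : square (eval v phi).
Proof.
rewrite /square /in01 /=; elim: phi => [p|f [? ?]|f [? ?]|f [? ?]|
  f [/andP[? ?] /andP[? ?]] g [/andP[? ?] /andP[? ?]]|
  f [/andP[? ?] /andP[? ?]] g [/andP[? ?] /andP[? ?]]|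
  f [/andP[? ?] /andP[? ?]] g [/andP[? ?] /andP[? ?]]|
  f [/andP[? ?] /andP[? ?]] g [/andP[? ?] /andP[? ?]]] /=.
- by split; [apply: val1P | apply: val2P].
- by split.
- by rewrite /gcoimp; split; case: ifP; rewrite ?lexx ?ler01.
- by split; case: ifP; rewrite ?lexx ?ler01.
- by split; apply/andP; rewrite ?le_min ?ge_min ?le_max ?ge_max; split;
    do ?[apply/andP; split|apply/orP; left] => //.
- by split; apply/andP; rewrite ?le_min ?ge_min ?le_max ?ge_max; split;
    do ?[apply/andP; split|apply/orP; left] => //.
- by rewrite /gimp /gcoimp; split; case: ifP => _; rewrite ?lexx ?ler01 //; apply/andP.
- by rewrite /gimp /gcoimp; split; case: ifP => _; rewrite ?lexx ?ler01 //; apply/andP.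
Qed.

Lemma point_generated_filter (D : set (R * R)) :
  point_generated D -> is_filter D.
Proof.
move=> [[x y] [sa na ->]]; split.
- by move=> b [].
- by exists (x, y); split=> //; split.
- move=> E; apply: na.
  have : upset (x, y) (0, 1).
    by rewrite E; split; rewrite /in01 /= ?lexx ?ler01.
  move=> [_ [/= x0 y1]]; case: sa => /andP[/= x0' _] /andP[_ /= y1'].
  by congr pair; apply/eqP; rewrite eq_le ?x0 ?x0' ?y1 ?y1'.
- move=> a b [[/andP[a1 a2] /andP[a3 a4]] [a5 a6]].
  move=> [[/andP[b1 b2] /andP[b3 b4]] [b5 b6]]; split; split; rewrite /in01 /=.
  + by rewrite le_min ge_min a1 b1 a2.
  + by rewrite ge_max le_max a4 b4 a3.
  + by rewrite le_min; apply/andP.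
  + by rewrite ge_max; apply/andP.
- move=> a b [_ [h1 h2]] sb [h3 h4]; split=> //; split.
  + exact: le_trans h1 h3.
  + exact: le_trans h4 h2.
Qed.

End Semantics.

Arguments valuation : clear implicits.
Arguments valid : clear implicits.
Arguments square : clear implicits.

(* Main.v *)
Require Import Defs.
From mathcomp Require Import all_boot all_order all_algebra.
From mathcomp Require Import boolp classical_sets reals.
From mathcomp Require Import ring lra.

Local Open Scope classical_set_scope.

(** Two symmetries of the semantics carry the argument: an order embedding of
    [0, 1] fixing 0 and 1 acts on valuations componentwise and commutes with
    evaluation, and so does conflation <x, y> |-> <1 - y, 1 - x>.  Hence a
    non-valid formula takes values with first component arbitrarily close to 0,
    and also values with second component arbitrarily close to 1, so it leaves
    every point-generated filter.  Conversely, a filter contained in no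
    point-generated one contains <x, y> whenever 0 < x and y < 1, and
    the non-valid formula p \/ ~p only takes such values. *)

Import Order.TTheory GRing.Theory Num.Theory.
Local Open Scope ring_scope.

Section Symmetries.
Local Set Implicit Arguments.
Local Unset Strict Implicit.
Context {R : realType}.
Implicit Types (v : valuation R) (phi : formula).

Section Embedding.
Variable h : R -> R.
Hypothesis h0 : h 0 = 0.
Hypothesis h1 : h 1 = 1.
Hypothesis h_mono : forall a b, in01 a -> in01 b -> (h a <= h b) = (a <= b).

Let in01_0 : in01 (0 : R). Proof. by rewrite /in01 lexx ler01. Qed.
Let in01_1 : in01 (1 : R). Proof. by rewrite /in01 lexx ler01. Qed.

Lemma embedding_in01 a : in01 a -> in01 (h a).
Proof.
by move=> ha; rewrite /in01 -{1}h0 -{1}h1 !h_mono.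
Qed.

Lemma embedding_lt a b : in01 a -> in01 b -> (h a < h b) = (a < b).
Proof. by move=> ha hb; rewrite !ltNge h_mono. Qed.

Lemma embedding_eq a b : in01 a -> in01 b -> (h a == h b) = (a == b).
Proof. by move=> ha hb; rewrite !eq_le !h_mono. Qed.

Definition map_valuation v : valuation R :=
  Valuation (fun p => embedding_in01 (val1P v p))
            (fun p => embedding_in01 (val2P v p)).

(** Each connective only compares its arguments with each other or with 0 and 1, and returns one of
    them or 0 or 1; [h] preserves all of this. *)
Lemma eval_map_valuation v phi :
  eval (map_valuation v) phi = (h (eval v phi).1, h (eval v phi).2).
Proof.
have min_h a b : in01 a -> in01 b -> Num.min (h a) (h b) = h (Num.min a b).
  by move=> ha hb; rewrite !minElt embedding_lt //; case: ifP.
have max_h a b : in01 a -> in01 b -> Num.max (h a) (h b) = h (Num.max a b).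
  by move=> ha hb; rewrite !maxElt embedding_lt //; case: ifP.
have imp_h a b : in01 a -> in01 b -> gimp (h a) (h b) = h (gimp a b).
  by move=> ha hb; rewrite /gimp h_mono //; case: ifP.
have coimp_h a b : in01 a -> in01 b -> gcoimp (h a) (h b) = h (gcoimp a b).
  by move=> ha hb; rewrite /gcoimp h_mono //; case: ifP.
elim: phi => [p|f IH|f IH|f IH|f IHf g IHg|f IHf g IHg|f IHf g IHg|f IHf g IHg] //=.
all: rewrite ?IH ?IHf ?IHg /=.
- by [].
- have [a1 a2] := eval_square v f; congr pair; last by rewrite -coimp_h // h1.
  by rewrite -{1}h0 embedding_eq //; case: ifP.
- have [a1 a2] := eval_square v f; congr pair.
    by rewrite -{1}h1 embedding_eq //; case: ifP.
  by rewrite -{1}h0 embedding_lt //; case: ifP.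
all: have [a1 a2] := eval_square v f; have [b1 b2] := eval_square v g.
- by rewrite min_h // max_h.
- by rewrite min_h // max_h.
- by rewrite imp_h // coimp_h.
- by rewrite imp_h // coimp_h.
Qed.

End Embedding.

Lemma in01_onem (a : R) : in01 a -> in01 (1 - a).
Proof. by move=> /andP[a0 a1]; apply/andP; split; lra. Qed.

Definition conflation v : valuation R :=
  Valuation (fun p => in01_onem (val2P v p)) (fun p => in01_onem (val1P v p)).

(** The map [t] |-> [1 - t] reverses the order, so it exchanges min with max and [gimp] with
    [gcoimp] (arguments swapped), which is how the two components of each clause are related. *)
Lemma eval_conflation v phi :
  eval (conflation v) phi = (1 - (eval v phi).2, 1 - (eval v phi).1).
Proof.
have le_onem (a b : R) : (1 - a <= 1 - b) = (b <= a) by rewrite lerD2l lerN2.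
have lt_onem (a b : R) : (1 - a < 1 - b) = (b < a) by rewrite ltrD2l ltrN2.
have min_onem (a b : R) : Num.min (1 - a) (1 - b) = 1 - Num.max a b.
  by rewrite minEle maxEle le_onem; case: (ltgtP a b) => // ->.
have max_onem (a b : R) : Num.max (1 - a) (1 - b) = 1 - Num.min a b.
  by rewrite minEle maxEle le_onem; case: (ltgtP a b) => // ->.
have imp_onem (a b : R) : gimp (1 - a) (1 - b) = 1 - gcoimp b a.
  by rewrite /gimp /gcoimp le_onem; case: ifP; rewrite ?subr0.
have coimp_onem (a b : R) : gcoimp (1 - a) (1 - b) = 1 - gimp b a.
  by rewrite /gimp /gcoimp le_onem; case: ifP; rewrite ?subrr.
elim: phi => [p|f IH|f IH|f IH|f IHf g IHg|f IHf g IHg|f IHf g IHg|f IHf g IHg] //=.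
all: rewrite ?IH ?IHf ?IHg /=.
- by [].
- have [/andP[a1 _] /andP[_ a2]] := eval_square v f; congr pair; rewrite /gcoimp.
    by rewrite subr_eq0 (eq_sym 1) eq_le a2 /=; case: ifP; rewrite ?subr0 ?subrr.
  have -> : (1 <= 1 - (eval v f).1) = ((eval v f).1 == 0).
    by rewrite eq_le a1 andbT; apply/idP/idP => ?; lra.
  by case: ifP; rewrite ?subr0 ?subrr.
- have [/andP[_ a1] /andP[a2 _]] := eval_square v f; congr pair.
    have -> : (1 - (eval v f).2 == 1) = ~~ (0 < (eval v f).2).
      by rewrite -leNgt [RHS]le_eqVlt ltNge a2 orbF; apply/eqP/eqP => ?; lra.
    by case: (0 < (eval v f).2); rewrite /= ?subr0 ?subrr.
  by rewrite subr_gt0 lt_neqAle a1 andbT; case: eqP; rewrite ?subr0 ?subrr.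
- by rewrite min_onem max_onem.
- by rewrite min_onem max_onem.
- by rewrite imp_onem coimp_onem.
- by rewrite imp_onem coimp_onem.
Qed.

(** The Moebius maps [t / (t + k * (1 - t))] fix 0 and 1 and increase on [0, 1], where the
    denominator is positive; a large [k] pushes [c] towards 0. *)
Lemma embedding_below (c e : R) : 0 <= c < 1 -> 0 < e ->
  exists h : R -> R, [/\ h 0 = 0, h 1 = 1,
    forall a b, in01 a -> in01 b -> (h a <= h b) = (a <= b) & h c < e].
Proof.
(* This [k] makes [k * (1 - c)] equal to [1 / e], so that [h c] is [c * e / (c * e + 1)], which is
   below [e]. *)
move=> /andP[c0 c1] e0; pose k := (e * (1 - c))^-1.
have k0 : 0 < k by rewrite invr_gt0 mulr_gt0 // subr_gt0.
have den a : in01 a -> 0 < a + k * (1 - a).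
  by move=> /andP[a0 a1]; nra.
exists (fun t => t / (t + k * (1 - t))); split.
- by rewrite mul0r.
- by rewrite subrr mulr0 addr0 divr1.
- move=> a b ha hb; rewrite ler_pdivrMr ?den // mulrAC ler_pdivlMr ?den //.
  (* After cross-multiplication the terms in [a * b] cancel. *)
  rewrite -subr_ge0 (_ : _ - _ = k * (b - a)); last by ring.
  by rewrite pmulr_rge0 // subr_ge0.
- rewrite ltr_pdivrMr; last by apply: den; apply/andP; split=> //; apply: ltW.
  have kE : e * (k * (1 - c)) = 1.
    rewrite /k; field; apply/andP; split; lra.
  by rewrite mulrDr kE; nra.
Qed.

Lemma nonvalid_truth_small phi (e : R) : ~ valid R phi -> 0 < e ->
  exists v, (eval v phi).1 < e.
Proof.
move=> /existsNP[w nw] e0.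
have [v v1] : exists v, (eval v phi).1 < 1.
  have [/andP[_ w1] /andP[w2 _]] := eval_square w phi.
  have [?|w1'] := ltP (eval w phi).1 1; first by exists w.
  (* Here only the second component witnesses non-validity; conflation moves this defect to the
     first. *)
  exists (conflation w); rewrite eval_conflation /= ltrBlDr ltrDl lt_neqAle w2 andbT.
  apply/eqP => w2'; apply: nw; rewrite (surjective_pairing (eval w phi)) -w2'.
  by congr pair; apply/eqP; rewrite eq_le w1 w1'.
have [/andP[v0 _] _] := eval_square v phi.
have [|h [h0 h1 hm hc]] := @embedding_below (eval v phi).1 e _ e0.
  by rewrite v0.
by exists (map_valuation h0 h1 hm v); rewrite eval_map_valuation.
Qed.

Lemma nonvalid_falsity_large phi (e : R) : ~ valid R phi -> e < 1 ->
  exists v, e < (eval v phi).2.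
Proof.
move=> nv e1; have [|v hv] := @nonvalid_truth_small phi (1 - e) nv.
  by rewrite subr_gt0.
by exists (conflation v); rewrite eval_conflation /=; lra.
Qed.

Definition excluded_middle : formula := Or (Var 0) (Sim (Var 0)).

Lemma excluded_middle_not_valid : ~ valid R excluded_middle.
Proof.
have half01 : in01 (2^-1 : R) by apply/andP; split; lra.
move=> /(_ (Valuation (fun=> half01) (fun=> half01))) /= [].
by rewrite invr_eq0 pnatr_eq0 /= maxElt; case: ifP => _ ?; lra.
Qed.

(** If [p] has first component 0, then [~p] has 1; if [p] has second component 1, then [~p] has 0.
    Otherwise [p] itself gives the bound. *)
Lemma excluded_middle_bounds v :
  0 < (eval v excluded_middle).1 /\ (eval v excluded_middle).2 < 1.
Proof.
rewrite /= /gcoimp; have /andP[a0 _] := val1P v 0; have /andP[_ b1] := val2P v 0.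
split.
- by rewrite lt_max; case: eqP => [_|/eqP n0]; rewrite ?ltr01 ?orbT // lt_neqAle eq_sym n0 a0.
- by rewrite gt_min; case: (leP 1 (val2 v 0)) => // _; rewrite ltr01 orbT.
Qed.

(** Escaping the upsets of [(x, 1)] and [(0, y)] yields one element with small first component and
    one with large second component; their meet lies below [(x, y)]. *)
Lemma filter_sub_upset_or_interior (D : set (R * R)) : is_filter D ->
  (exists D', point_generated D' /\ D `<=` D') \/
  (forall a, square R a -> 0 < a.1 -> a.2 < 1 -> D a).
Proof.
move=> FD; have [|nD] := EM (exists D', point_generated D' /\ D `<=` D').
  by left.
right=> -[x y] sa /= x0 y1; have [/andP[/= _ x1] /andP[/= y0 _]] := sa.
have point_escape a : square R a -> a <> (0, 1) ->
    exists2 d, D d & ~ truth_le a d.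
  move=> sqa na; apply: contrapT => H; apply: nD; exists (upset a); split.
    by exists a.
  move=> d Dd; split; first exact: (filter_sub FD Dd).
  by apply: contrapT => ?; apply: H; exists d.
have [||d Dd nd] := point_escape (x, 1).
- by split; rewrite /in01 /= ?lexx ?ler01 // (ltW x0).
- by case=> x0'; rewrite x0' ltxx in x0.
have [||d' Dd' nd'] := point_escape (0, y).
- by split; rewrite /in01 /= ?lexx ?ler01 // y0 (ltW y1).
- by case=> y1'; rewrite y1' ltxx in y1.
apply: (filter_up FD (filter_meet FD Dd Dd')) => //.
have [_ /andP[_ d2]] := filter_sub FD Dd; have [/andP[d1' _] _] := filter_sub FD Dd'.
split=> /=.
(* Since [d.2 <= 1] always holds, failing to be above [(x, 1)] means [d.1 < x]; dually for [d']. *)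
- by rewrite ge_min; apply/orP; left; rewrite leNgt; apply/negP => /ltW ?; apply: nd.
- by rewrite le_max; apply/orP; right; rewrite leNgt; apply/negP => /ltW ?; apply: nd'.
Qed.

End Symmetries.

Theorem theorem8 (R : realType) (D : set (R * R)) (hD : is_filter D) :
  validity_stable D <->
  exists D' : set (R * R), point_generated D' /\ D `<=` D'.
Proof.
split.
- move=> stab; have [//|Dint] := filter_sub_upset_or_interior hD.
  case: (@excluded_middle_not_valid R); apply/stab => v.
  have [? ?] := excluded_middle_bounds v.
  by apply: Dint => //; apply: eval_square.
- move=> [_ [[[x y] [[/andP[/= x0 x1] /andP[/= y0 y1]] nxy ->]] sub]] phi.
  split=> [Dphi|val v]; last first.
    have [a Da] := filter_nonempty hD.
    have [/andP[_ a1] /andP[a2 _]] := filter_sub hD Da.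
    rewrite val; apply: (filter_up hD Da); last by split.
    by split; rewrite /in01 /= ?lexx ?ler01.
  (* The generator differs from [(0, 1)], so [0 < x] or [y < 1]; either bound is violated by some
     value of a non-valid formula. *)
  apply: contrapT => nv; have [xpos|x0'] := ltP 0 x.
    have [v vx] := nonvalid_truth_small nv xpos.
    by have [_ [/= xv _]] := sub _ (Dphi v); rewrite ltNge xv in vx.
  have y1' : y < 1.
    rewrite lt_neqAle y1 andbT; apply/eqP => yE; apply: nxy.
    by rewrite yE; congr pair; apply/eqP; rewrite eq_le x0' x0.
  have [v vy] := nonvalid_falsity_large nv y1'.
  by have [_ [_ /= yv]] := sub _ (Dphi v); rewrite ltNge yv in vy.
Qed.
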